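(* For every joint distribution $(X,Z)$ on $\mathcal{X}\times\{0,1\}^{\lambda}$ and all parameters $\epsilon>0$ and $s$, there exists a (randomized) simulator $\mathsf{h}:\mathcal{X}\rightarrow \{0,1\}^{\lambda}$ such that (a) the distributions $(X,\mathsf{h}(X))$ and $(X,Z)$ are $(s,\epsilon)$-indistinguishable, and (b) $\mathsf{h}$ has complexity $s_{\mathsf{h}} = O\!\left(s\cdot 2^{2\lambda}\epsilon^{-4}\right)$.
   Context: Two distributions $Y_1,Y_2$ on the same domain are $(s,\epsilon)$-indistinguishable if for every distinguisher $\textsc{D}$ (a circuit) of size at most $s$, $\left|\Pr[\textsc{D}(Y_1)=1]-\Pr[\textsc{D}(Y_2)=1]\right|\leqslant \epsilon$. The complexity of the simulator $\mathsf{h}$ is its size as a (randomized) circuit. *)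

(* Defs.v *)
From mathcomp Require Import all_boot all_order all_algebra.
From mathcomp Require Import reals.
Set Implicit Arguments. Unset Strict Implicit. Unset Printing Implicit Defensive.
Import Order.TTheory GRing.Theory Num.Theory.
Local Open Scope ring_scope.

(** Boolean circuits over the basis {AND, OR, NOT} (fan-in <= 2) with constant
    gates.  Wires are numbered: the k inputs are wires 0..k-1, and the i-th gate
    (0-based) defines wire k+i.  A gate may only read earlier wires. *)
Inductive gate : Type :=
| GConst of bool
| GNot of nat
| GAnd of nat & nat
| GOr of nat & nat.

Record circuit : Type := Circuit { gates : seq gate; outs : seq nat }.

Definition csize (c : circuit) : nat := size (gates c).

Definition gate_val (g : gate) (vals : seq bool) : bool :=
  match g with
  | GConst b => b
  | GNot i => ~~ nth false vals i
  | GAnd i j => nth false vals i && nth false vals j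
  | GOr i j => nth false vals i || nth false vals j
  end.

Definition gate_wf (g : gate) (w : nat) : bool :=
  match g with
  | GConst _ => true
  | GNot i => (i < w)%N
  | GAnd i j | GOr i j => (i < w)%N && (j < w)%N
  end.

Fixpoint gates_wf (gs : seq gate) (w : nat) : bool :=
  match gs with
  | [::] => true
  | g :: gs' => gate_wf g w && gates_wf gs' w.+1
  end.

Definition wf_circuit (c : circuit) (k l : nat) : bool :=
  [&& gates_wf (gates c) k, size (outs c) == l
    & all (fun o => (o < k + csize c)%N) (outs c)].

Fixpoint run (gs : seq gate) (vals : seq bool) : seq bool :=
  match gs with
  | [::] => vals
  | g :: gs' => run gs' (rcons vals (gate_val g vals))
  end.

Definition eval (c : circuit) (inp : seq bool) : seq bool :=
  let w := run (gates c) inp in map (fun o => nth false w o) (outs c).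

Definition eval1 (c : circuit) (inp : seq bool) : bool := head false (eval c inp).

Definition bits (n : nat) := n.-tuple bool.

Section Prob.
Variable R : realType.
Variables n lam : nat.
Definition jtype := (bits n * bits lam)%type.

Definition is_distr (P : {ffun jtype -> R}) : Prop :=
  (forall y, 0 <= P y) /\ \sum_y P y = 1.

Definition prD (P : {ffun jtype -> R}) (D : circuit) : R :=
  \sum_y P y * (eval1 D (val y.1 ++ val y.2) : nat)%:R.

Definition indist (s : nat) (eps : R) (P1 P2 : {ffun jtype -> R}) : Prop :=
  forall D : circuit, wf_circuit D (n + lam) 1 -> (csize D <= s)%N ->
    `| prD P1 D - prD P2 D | <= eps.

(** The distribution of (X, h(X)) where X is the first marginal of P and
    h is a randomized circuit with inputs x ++ r, r uniform in {0,1}^m. *)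
Definition sim_joint (P : {ffun jtype -> R}) (m : nat) (h : circuit)
  : {ffun jtype -> R} :=
  [ffun y : jtype =>
     (\sum_(z : bits lam) P (y.1, z)) *
     ((#|[set r : bits m | eval h (val y.1 ++ val r) == val y.2]|)%:R
        / (2 ^+ m))].
End Prob.

(* Main.v *)
(** For a fixed [x], producing [z] is an online prediction problem with the
    [2 ^ lam] values of [z] as experts.  Given tests [f_1, ..., f_t] (circuits
    of size [s], possibly negated), the simulator outputs the perturbed leader:
    the [z] maximizing [#{j | f_j (x, z) = 1} + N_z], where the [N_z] are
    independent copies of [2 ^ a * G + U], with [G] geometric truncated at [lam]
    and [U] uniform below [2 ^ a].  The hazard rate of this noise is about
    [2 ^ -a], so one more test changes the leader with probability at most
    [4 / 2 ^ a]; as the noise is at most [(lam + 1) * 2 ^ a], the regret after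
    [T] tests is at most [(lam + 1) * 2 ^ a + 4 * T / 2 ^ a].

    If each of these simulators were distinguished from [(X, Z)], adding the
    distinguishing test again and again would give [T] tests with a regret
    larger than [eps * T], a contradiction for [2 ^ a >= 8 / eps] and
    [T = (lam + 1) * 4 ^ a].

    The circuit keeps the scores of all [z] in unary, with [O(T)] wires each;
    this costs [O(2 ^ lam * (T * s + T ^ 2))] gates, which is
    [O(s * 2 ^ (2 * lam) / eps ^ 4)] since [(lam + 1) ^ 2 = O(2 ^ lam)].  Random
    bits are free inputs.  For [eps >= 1] a circuit without gates is needed, and
    copying random bits to the output is enough. *)

Require Import Defs.
From mathcomp Require Import all_boot all_order all_algebra.
From mathcomp Require Import reals boolp zify ring lra.
Set Implicit Arguments. Unset Strict Implicit. Unset Printing Implicit Defensive.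
Import Order.TTheory GRing.Theory Num.Theory.

(** * Circuit synthesis *)

Lemma run_cat gs1 gs2 vals : run (gs1 ++ gs2) vals = run gs2 (run gs1 vals).
Proof. by elim: gs1 vals => //= g gs1 IH vals; rewrite IH. Qed.

Lemma size_run gs vals : size (run gs vals) = size vals + size gs.
Proof.
by elim: gs vals => [|g gs IH] vals /=; rewrite ?addn0 // IH size_rcons addSnnS.
Qed.

Lemma nth_run gs vals i :
  i < size vals -> nth false (run gs vals) i = nth false vals i.
Proof.
elim: gs vals => //= g gs IH vals lti.
by rewrite IH ?size_rcons ?nth_rcons ?lti // ltnW.
Qed.

Lemma gates_wf_cat gs1 gs2 w :
  gates_wf (gs1 ++ gs2) w = gates_wf gs1 w && gates_wf gs2 (w + size gs1).
Proof.
by elim: gs1 w => [|g gs1 IH] w /=; rewrite ?addn0 // IH addSnnS andbA.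
Qed.

Section Synthesis.
Variable k : nat.
Implicit Types (gs : seq gate) (f g b : seq bool -> bool) (V : seq bool -> nat).

(** Hides the wire number: a wire is known only by the Boolean function it computes on inputs of
    length [k]. *)
Definition wired gs f := exists2 w, w < k + size gs &
  forall inp, size inp = k -> nth false (run gs inp) w = f inp.

(** Extension is semantic: every function computed so far is kept, so constructions compose and
    their costs add up. *)
Definition extends d gs gs' :=
  [/\ gates_wf gs' k, size gs' <= size gs + d
    & forall f, wired gs f -> wired gs' f].

Definition synth gs d f := exists2 gs', extends d gs gs' & wired gs' f.

Lemma wired_eq gs f g : (forall inp, size inp = k -> f inp = g inp) ->
  wired gs f -> wired gs g.
Proof. by move=> fg [w ltw Hw]; exists w => // inp sz; rewrite Hw ?fg. Qed.

Lemma wired_input gs i : i < k -> wired gs (nth false ^~ i).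
Proof.
move=> ltik; exists i; first exact: ltn_addr.
by move=> inp sz; rewrite nth_run // sz.
Qed.

Lemma extends_refl gs : gates_wf gs k -> extends 0 gs gs.
Proof. by move=> wf; split; rewrite ?addn0. Qed.

Lemma extends_trans d1 d2 gs1 gs2 gs3 :
  extends d1 gs1 gs2 -> extends d2 gs2 gs3 -> extends (d1 + d2) gs1 gs3.
Proof.
move=> [_ s12 w12] [wf3 s23 w23]; split=> // [|f /w12/w23 //].
by rewrite addnA (leq_trans s23) // leq_add2r.
Qed.

Lemma extends_leq d1 d2 gs gs' : d1 <= d2 -> extends d1 gs gs' -> extends d2 gs gs'.
Proof.
by move=> le12 [wf sz w]; split=> //; rewrite (leq_trans sz) // leq_add2l.
Qed.

Lemma extends_wf d gs gs' : extends d gs gs' -> gates_wf gs' k.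
Proof. by case. Qed.

Lemma extends_wired d gs gs' f : extends d gs gs' -> wired gs f -> wired gs' f.
Proof. by case=> _ _; apply. Qed.

Lemma synth_eq gs d f g : (forall inp, size inp = k -> f inp = g inp) ->
  synth gs d f -> synth gs d g.
Proof. by move=> fg [gs' e w]; exists gs' => //; apply: wired_eq w. Qed.

Lemma synth_wired gs f : gates_wf gs k -> wired gs f -> synth gs 0 f.
Proof. by move=> wf w; exists gs => //; apply: extends_refl. Qed.

Lemma synth_leq gs d1 d2 f : d1 <= d2 -> synth gs d1 f -> synth gs d2 f.
Proof. by move=> le [gs' e w]; exists gs' => //; apply: extends_leq e. Qed.

Lemma synth_gate gs ga : gates_wf gs k -> gate_wf ga (k + size gs) ->
  synth gs 1 (fun inp => gate_val ga (run gs inp)).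
Proof.
move=> wf wfg; exists (rcons gs ga).
  split; first by rewrite -cats1 gates_wf_cat wf /= wfg.
    by rewrite size_rcons addn1.
  move=> f [w ltw Hw]; exists w; first by rewrite size_rcons addnS ltnW.
  by move=> inp sz; rewrite -cats1 run_cat nth_run ?size_run ?sz // Hw.
exists (k + size gs); first by rewrite size_rcons addnS.
by move=> inp sz; rewrite -cats1 run_cat /= nth_rcons size_run sz ltnn eqxx.
Qed.

Lemma synth_const gs c : gates_wf gs k -> synth gs 1 (fun=> c).
Proof. by move=> wf; apply: (@synth_gate gs (GConst c)). Qed.

Lemma synth_not gs f : gates_wf gs k -> wired gs f -> synth gs 1 (fun inp => ~~ f inp).
Proof.
move=> wf [w ltw Hw]; apply: (@synth_eq _ _ _ _ _ (@synth_gate gs (GNot w) wf ltw)).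
by move=> inp sz /=; rewrite Hw.
Qed.

Lemma synth_and gs f g : gates_wf gs k -> wired gs f -> wired gs g ->
  synth gs 1 (fun inp => f inp && g inp).
Proof.
move=> wf [w ltw Hw] [v ltv Hv]; have wfg: gate_wf (GAnd w v) (k + size gs).
  by rewrite /= ltw.
by apply: synth_eq (synth_gate wf wfg) => inp sz /=; rewrite Hw ?Hv.
Qed.

Lemma synth_or gs f g : gates_wf gs k -> wired gs f -> wired gs g ->
  synth gs 1 (fun inp => f inp || g inp).
Proof.
move=> wf [w ltw Hw] [v ltv Hv]; have wfg: gate_wf (GOr w v) (k + size gs).
  by rewrite /= ltw.
by apply: synth_eq (synth_gate wf wfg) => inp sz /=; rewrite Hw ?Hv.
Qed.

Lemma synth_or_and gs f g b : gates_wf gs k -> wired gs f -> wired gs g ->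
  wired gs b -> synth gs 2 (fun inp => f inp || g inp && b inp).
Proof.
move=> wf wf' wg wb; have [gs1 e1 w1] := synth_and wf wg wb.
have [gs2 e2 w2] := synth_or (extends_wf e1) (extends_wired e1 wf') w1.
by exists gs2 => //; apply: extends_trans e1 e2.
Qed.

Lemma extends_seq (I : eqType) (s : seq I) (Phi : I -> seq gate -> Prop) d gs0 :
  gates_wf gs0 k ->
  (forall i d' gs gs', Phi i gs -> extends d' gs gs' -> Phi i gs') ->
  (forall i d' gs, i \in s -> extends d' gs0 gs ->
     exists2 gs', extends d gs gs' & Phi i gs') ->
  exists2 gs', extends (size s * d) gs0 gs' & forall i, i \in s -> Phi i gs'.
Proof.
move=> wf0 mono; elim: s => [|i s IH] step.
  by exists gs0 => //; apply: extends_refl.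
have [|gs1 e1 H1] := IH; first by move=> j d' gs js; apply: step; rewrite inE js orbT.
have [gs2 e2 H2] := step i _ _ (mem_head i s) e1.
exists gs2; first by rewrite /= mulSn addnC; apply: extends_trans e1 e2.
by move=> j; rewrite inE => /orP[/eqP->|/H1 Hj] //; apply: mono e2.
Qed.

Lemma synth_has (I : eqType) (s : seq I) (P : I -> seq bool -> bool) d gs :
  gates_wf gs k -> wired gs (fun=> false) ->
  (forall i d' gs', i \in s -> extends d' gs gs' -> synth gs' d (P i)) ->
  synth gs (size s * d.+1) (fun inp => has (P ^~ inp) s).
Proof.
move=> wf w0; elim: s => [|i s IH] step; first exact: synth_wired.
have [|gs1 e1 H1] := IH; first by move=> j d' gs' js; apply: step; rewrite inE js orbT.
have [gs2 e2 H2] := step i _ _ (mem_head i s) e1.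
have [gs3 e3 H3] := synth_or (extends_wf e2) H2 (extends_wired e2 H1).
exists gs3 => //=; rewrite mulSn addnC; apply: extends_trans e1 _.
by rewrite -addn1; apply: extends_trans e2 e3.
Qed.

(** Copies [cg] into [gs] with arbitrary computed functions as its inputs. The list [gl] follows the
    wires of [cg] symbolically, each entry being the function of the outer input carried by that
    wire. *)
Lemma extends_run cg (gl : seq (seq bool -> bool)) gs :
  gates_wf cg (size gl) -> gates_wf gs k ->
  (forall i, i < size gl -> wired gs (nth (fun=> false) gl i)) ->
  exists gl' gs', [/\ extends (size cg) gs gs', size gl' = size gl + size cg,
    forall i, i < size gl' -> wired gs' (nth (fun=> false) gl' i)
  & forall inp, run cg [seq f inp | f <- gl] = [seq f inp | f <- gl']].
Proof.
elim: cg gl gs => [|ga cg IH] gl gs /=.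
  by move=> _ wf H; exists gl, gs; split; rewrite ?addn0 //; apply: extends_refl.
move=> /andP[wga wcg] wf H.
have nthgl inp i : i < size gl ->
    nth false [seq f inp | f <- gl] i = nth (fun=> false) gl i inp.
  by move=> lti; rewrite (nth_map (fun=> false)).
have [gs1 e1 H1] : synth gs 1 (fun inp => gate_val ga [seq f inp | f <- gl]).
  case: ga wga => [c|i|i j|i j] /=; first by move=> _; apply: synth_const.
  - move=> lti; apply: synth_eq (synth_not wf (H _ lti)) => inp _.
    by rewrite nthgl.
  - case/andP=> lti ltj; apply: synth_eq (synth_and wf (H _ lti) (H _ ltj)) => inp _.
    by rewrite !nthgl.
  - case/andP=> lti ltj; apply: synth_eq (synth_or wf (H _ lti) (H _ ltj)) => inp _.
    by rewrite !nthgl.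
have [|||gl' [gs2 [e2 sz H2 r2]]] :=
    IH (rcons gl (fun inp => gate_val ga [seq f inp | f <- gl])) gs1.
- by rewrite size_rcons.
- exact: extends_wf e1.
- move=> i; rewrite size_rcons ltnS nth_rcons => lei.
  case: (ltnP i (size gl)) => [lti|gei]; first exact: extends_wired e1 (H _ lti).
  by have -> : i == size gl by rewrite eqn_leq lei.
exists gl', gs2; split=> //; first by rewrite -add1n; apply: extends_trans e1 e2.
  by rewrite sz size_rcons addSnnS.
by move=> inp; rewrite -r2 map_rcons.
Qed.

Lemma synth_eval1 D (gl : seq (seq bool -> bool)) gs :
  wf_circuit D (size gl) 1 -> gates_wf gs k ->
  (forall i, i < size gl -> wired gs (nth (fun=> false) gl i)) ->
  synth gs (csize D) (fun inp => eval1 D [seq f inp | f <- gl]).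
Proof.
case/and3P=> wfD szo /allP ao wf H.
have [gl' [gs' [e sz H' r]]] := extends_run wfD wf H.
exists gs' => //; rewrite /eval1 /eval.
case: (outs D) szo ao => [|o [|o' os]] //= _ /(_ o (mem_head _ _)) lto.
apply: wired_eq (H' o _); last by rewrite sz.
by move=> inp _; rewrite r (nth_map (fun=> false)) // sz.
Qed.

(** * Unary counters *)

(** Thermometer code. A value above [W] is seen only as at least [W], hence the bound required when
    two values are compared. *)
Definition unary W gs V := forall j, j <= W -> wired gs (fun inp => j <= V inp).

Lemma extends_unary d W gs gs' V : extends d gs gs' -> unary W gs V -> unary W gs' V.
Proof. by move=> e u j /u; apply: extends_wired e. Qed.

Lemma unary_eq W gs V V' : (forall inp, size inp = k -> V inp = V' inp) ->
  unary W gs V -> unary W gs V'.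
Proof. by move=> E u j /u; apply: wired_eq => inp /E ->. Qed.

Lemma unary_step W d gs V : gates_wf gs k ->
  (forall j d' gs', j <= W -> extends d' gs gs' -> synth gs' d (fun inp => j <= V inp)) ->
  exists2 gs', extends (W.+1 * d) gs gs' & unary W gs' V.
Proof.
move=> wf step.
have [||gs' e H] := @extends_seq _ (iota 0 W.+1)
    (fun j gs' => wired gs' (fun inp => j <= V inp)) d gs wf.
- by move=> j d' gs1 gs2 w e; apply: extends_wired e w.
- by move=> j d' gs1; rewrite mem_iota => lej; apply: step.
exists gs'; first by rewrite size_iota in e.
by move=> j lej; apply: H; rewrite mem_iota.
Qed.

Lemma unary0 W gs : wired gs (fun=> true) -> wired gs (fun=> false) ->
  unary W gs (fun=> 0).
Proof. by move=> wt wf [|j] _. Qed.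

(** [j + 1 <= V + b] iff [j + 1 <= V], or [j <= V] and [b]: two gates per threshold, without
    carries. *)
Lemma unary_addb W gs V b : gates_wf gs k -> unary W gs V -> wired gs b ->
  exists2 gs', extends (W.+1 * 2) gs gs' & unary W gs' (fun inp => V inp + b inp).
Proof.
move=> wf u wb; apply: unary_step => // -[|j] d' gs' ltj e.
  apply: (@synth_leq _ 0) => //; apply: synth_wired (extends_wf e) _.
  exact: extends_wired e (u 0 _).
apply: synth_eq (synth_or_and (extends_wf e) (extends_wired e (u j.+1 ltj))
  (extends_wired e (u j (ltnW ltj))) (extends_wired e wb)) => inp _.
by case: (b inp); lia.
Qed.

Lemma unary_geo W gs V b : gates_wf gs k -> unary W gs V -> wired gs b ->
  exists2 gs', extends (W.+1 * 2) gs gs' &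
    unary W gs' (fun inp => if b inp then (V inp).+1 else 0).
Proof.
move=> wf u wb; apply: unary_step => // -[|j] d' gs' ltj e; apply: synth_leq.
- exact: (leq0n 2).
- by apply: synth_wired (extends_wf e) _; apply: extends_wired e (u 0 _).
- exact: (leqnSn 1).
apply: synth_eq (synth_and (extends_wf e) (extends_wired e wb)
  (extends_wired e (u j (ltnW ltj)))) => inp _.
by case: (b inp).
Qed.

(** The even threshold [2 i] amounts to [i <= V], a wire already present; the odd one [2 i + 1] to
    [i + 1 <= V], or [i <= V] and [b]. *)
Lemma unary_double W gs V b : gates_wf gs k -> unary W gs V -> wired gs b ->
  exists2 gs', extends (W.+1 * 2) gs gs' &
    unary W gs' (fun inp => (V inp).*2 + b inp).
Proof.
move=> wf u wb; apply: unary_step => // j d' gs' ltj e.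
have [i [jE|jE]] : exists i, j = i.*2 \/ j = i.*2.+1.
- by exists j./2; have := odd_double_half j; case: (odd j); [right|left]; lia.
- apply: (@synth_leq _ 0) => //; apply: synth_wired (extends_wf e) _.
  apply: extends_wired e _; apply: wired_eq (u i _); last by lia.
  by move=> inp _; case: (b inp); lia.
- have lei : i <= W by lia.
  have lei1 : i.+1 <= W by lia.
  apply: synth_eq (synth_or_and (extends_wf e) (extends_wired e (u _ lei1))
    (extends_wired e (u _ lei)) (extends_wired e wb)) => inp _.
  by case: (b inp); lia.
Qed.

Lemma unary_max W gs V V' : gates_wf gs k -> unary W gs V -> unary W gs V' ->
  exists2 gs', extends (W.+1 * 1) gs gs' &
    unary W gs' (fun inp => maxn (V inp) (V' inp)).
Proof.
move=> wf u u'; apply: unary_step => // j d' gs' lej e.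
apply: synth_eq (synth_or (extends_wf e) (extends_wired e (u j lej))
  (extends_wired e (u' j lej))) => inp _.
by rewrite leq_max.
Qed.

(** Some threshold is met by [V'] but not by [V]. If [V < V'], then [V + 1] is one, and [V' <= W]
    ensures that it has a wire. *)
Lemma synth_unary_lt W gs V V' : gates_wf gs k -> wired gs (fun=> false) ->
  unary W gs V -> unary W gs V' -> (forall inp, size inp = k -> V' inp <= W) ->
  synth gs (W * 3) (fun inp => V inp < V' inp).
Proof.
move=> wf w0 u u' leW.
pose P j inp := ~~ (j.+1 <= V inp) && (j.+1 <= V' inp).
apply: (@synth_eq _ _ (fun inp => has (P ^~ inp) (iota 0 W))); rewrite /P.
  move=> inp sz; apply/hasP/idP => [[j _ /andP[]]|ltV]; first by lia.
  exists (V inp); last by rewrite ltnn.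
  by rewrite mem_iota add0n (leq_trans ltV) // leW.
rewrite -{1}(size_iota 0 W).
apply: (@synth_has _ (iota 0 W) P 2) => //.
move=> j d' gs'; rewrite mem_iota add0n => /= ltj e.
have [gs1 e1 w1] := synth_not (extends_wf e) (extends_wired e (u _ ltj)).
have [gs2 e2 w2] := synth_and (extends_wf e1) w1
  (extends_wired e1 (extends_wired e (u' _ ltj))).
by exists gs2 => //; apply: extends_trans e1 e2.
Qed.

End Synthesis.

(** * The perturbed leader and its circuit *)

Fixpoint geo (y : seq bool) : nat :=
  if y is b :: y' then if b then (geo y').+1 else 0 else 0.

(* [2 ^ a * G + U]: the first [a] bits give [U], least significant bit first,
   and the others give [G], their number of leading ones. *)
Fixpoint noise (a : nat) (y : seq bool) : nat :=
  match a, y with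
  | a'.+1, b :: y' => (noise a' y').*2 + b
  | _, _ => geo y
  end.

(** A left-to-right scan, which the circuit can follow step by step. All of [I] is visited, so [i0]
    matters only for ties. *)
Definition leader (I : finType) (i0 : I) (V : I -> nat) : I :=
  foldl (fun c i => if V c < V i then i else c) i0 (enum I).

Lemma leader_max (I : finType) (i0 : I) (V : I -> nat) i : V i <= V (leader i0 V).
Proof.
rewrite /leader; have : i \in enum I by rewrite mem_enum.
have mono s c : V c <= V (foldl (fun c i => if V c < V i then i else c) c s).
  elim: s c => //= j s IH c; apply: leq_trans (IH _).
  by case: ltnP => // /ltnW.
elim: (enum I) i0 => //= j s IH c; rewrite inE => /orP[/eqP->|/IH //].
by apply: leq_trans (mono _ _); case: ltnP.
Qed.

Lemma eq_leader (I : finType) (i0 : I) (V V' : I -> nat) :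
  V =1 V' -> leader i0 V = leader i0 V'.
Proof.
by move=> E; rewrite /leader; elim: (enum I) i0 => //= j s IH c; rewrite !E IH.
Qed.

(* A distinguisher or, when the boolean is set, its negation. *)
Definition signed_val (f : bool * circuit) (x z : seq bool) : bool :=
  f.1 (+) eval1 f.2 (x ++ z).

(** The test reads the input wires of [x] and hard-wired constants for [z]; the extra gate is the
    negation. *)
Lemma synth_signed_val k n lam (f : bool * circuit) (z : bits lam) gs :
  n <= k -> wf_circuit f.2 (n + lam) 1 -> gates_wf gs k ->
  wired k gs (fun=> true) -> wired k gs (fun=> false) ->
  synth k gs (csize f.2).+1 (fun inp => signed_val f (take n inp) z).
Proof.
move=> lenk wfD wf wt w0.
pose gl := [seq nth false ^~ i | i <- iota 0 n] ++ [seq (fun _ : seq bool => b) | b <- z].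
have szgl : size gl = n + lam by rewrite size_cat !size_map size_iota size_tuple.
have [||gs1 e1 w1] := @synth_eval1 k f.2 gl gs _ wf; first by rewrite szgl.
  move=> i; rewrite szgl /gl nth_cat size_map size_iota => lti.
  case: ltnP => [ltin|lein].
    rewrite (nth_map 0) ?size_iota // nth_iota //.
    by apply: wired_input; rewrite add0n (leq_trans ltin).
  by rewrite (nth_map false) ?size_tuple; [case: (nth _ _ _) | lia].
have glE inp : size inp = k -> [seq f inp | f <- gl] = take n inp ++ z.
  move=> sz; rewrite map_cat -!map_comp map_id_in // map_nth_iota0 ?sz //.
rewrite /signed_val; case: f.1 => /=.
  have [gs2 e2 w2] := synth_not (extends_wf e1) w1.
  exists gs2; first by rewrite -addn1; apply: extends_trans e1 e2.
  by apply: wired_eq w2 => inp sz; rewrite glE.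
exists gs1; first exact: extends_leq (leqnSn _) e1.
by apply: wired_eq w1 => inp sz; rewrite glE.
Qed.

Lemma unary_noise k W gs a (fl : seq (seq bool -> bool)) :
  gates_wf gs k -> wired k gs (fun=> true) -> wired k gs (fun=> false) ->
  (forall i, i < size fl -> wired k gs (nth (fun=> false) fl i)) ->
  exists2 gs', extends k (size fl * (W.+1 * 2)) gs gs' &
    unary k W gs' (fun inp => noise a [seq f inp | f <- fl]).
Proof.
move=> wf wt w0; elim: fl a => [|f fl IH] a H.
  exists gs; first exact: extends_refl.
  by apply: unary_eq (@unary0 k W gs wt w0) => inp _; case: a.
rewrite /= mulSn addnC; case: a => [|a].
  have [|gs1 e1 u1] := IH 0; first by move=> i; apply: (H i.+1).
  have [gs2 e2 u2] := unary_geo (extends_wf e1) u1 (extends_wired e1 (H 0 isT)).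
  exists gs2; first exact: extends_trans e1 e2.
  exact: u2.
have [|gs1 e1 u1] := IH a; first by move=> i; apply: (H i.+1).
have [gs2 e2 u2] := unary_double (extends_wf e1) u1 (extends_wired e1 (H 0 isT)).
by exists gs2 => //; apply: extends_trans e1 e2.
Qed.

Lemma unary_add_count k W gs n lam s (fs : seq (bool * circuit)) (z : bits lam) V :
  n <= k -> gates_wf gs k -> wired k gs (fun=> true) -> wired k gs (fun=> false) ->
  all (fun f => wf_circuit f.2 (n + lam) 1 && (csize f.2 <= s)) fs ->
  unary k W gs V ->
  exists2 gs', extends k (size fs * (s.+1 + W.+1 * 2)) gs gs' &
    unary k W gs' (fun inp => V inp + count (fun f => signed_val f (take n inp) z) fs).
Proof.
move=> lenk wf wt w0; elim: fs => [|f fs IH] /=.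
  move=> _ u; exists gs; first exact: extends_refl.
  by apply: unary_eq u => inp _; rewrite addn0.
move=> /andP[/andP[wfD szD] afs] u; have [gs1 e1 u1] := IH afs u.
have [gs2 e2 w2] := synth_signed_val z lenk wfD (extends_wf e1)
  (extends_wired e1 wt) (extends_wired e1 w0).
have [gs3 e3 u3] := unary_addb (extends_wf e2) (extends_unary e2 u1) w2.
exists gs3; last by apply: unary_eq u3 => inp _; rewrite addnAC addnA.
rewrite mulSn addnC; apply: extends_trans e1 _.
by apply: extends_trans e3; apply: extends_leq e2.
Qed.

(** The circuit carries the bits of the current candidate and its unary score. One scan step costs
    [W * 3] gates for the comparison, one for its negation, [lam] for the candidate and [W.+1] for
    the maximum. *)
Lemma wired_leader k W gs lam (V : bits lam -> seq bool -> nat) (z0 : bits lam) :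
  gates_wf gs k -> wired k gs (fun=> true) -> wired k gs (fun=> false) ->
  (forall z, unary k W gs (V z)) ->
  (forall z inp, size inp = k -> V z inp <= W) ->
  exists2 gs', extends k (2 ^ lam * (W * 3 + 1 + lam + W.+1)) gs gs' &
    forall i, wired k gs' (fun inp => tnth (leader z0 (V ^~ inp)) i).
Proof.
move=> wf wt w0 uV leW.
have -> : 2 ^ lam = size (enum {: bits lam}) by rewrite -cardE card_tuple card_bool.
rewrite /leader; move: (enum _) => s.
(* The start is generalized to a function of the input, as the candidate becomes one after a scan
   step. *)
pose c0 (inp : seq bool) := z0.
have : exists2 gs', extends k (size s * (W * 3 + 1 + lam + W.+1)) gs gs' &
  (forall i, wired k gs' (fun inp => tnth (foldl
     (fun c i => if V c inp < V i inp then i else c) (c0 inp) s) i)) ; last by [].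
have : forall i, wired k gs (fun inp => tnth (c0 inp) i).
  by move=> i; rewrite /c0; case: (tnth z0 i).
have : unary k W gs (fun inp => V (c0 inp) inp) by apply: uV.
elim: s c0 gs wf wt w0 uV => [|z s IH] c gs wf wt w0 uV uc wc.
  by exists gs => //; apply: extends_refl.
have [gs1 e1 g1] := synth_unary_lt wf w0 uc (uV z) (leW z).
have [gs2 e2 g2] := synth_not (extends_wf e1) g1.
have e02 := extends_trans e1 e2.
pose c' inp := if V (c inp) inp < V z inp then z else c inp.
have [||gs3 e3 w3] := @extends_seq k _ (enum 'I_lam)
  (fun i gs' => wired k gs' (fun inp => tnth (c' inp) i)) 1 gs2 (extends_wf e2).
- by move=> i d g g' w e; apply: extends_wired e w.
- move=> i d g _ e; change (synth k g 1 (fun inp => tnth (c' inp) i)).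
  have wci := extends_wired e (extends_wired e02 (wc i)).
  (* The bits of [z] are constants, so selecting between [c] and [z] takes one gate per bit: OR with
     the comparison for a one, AND with its negation for a zero. *)
  case zi : (tnth z i).
    apply: synth_eq (synth_or (extends_wf e) wci
      (extends_wired e (extends_wired e2 g1))) => inp _.
    by rewrite /c'; case: ltnP; rewrite ?zi ?orbT ?orbF.
  apply: synth_eq (synth_and (extends_wf e) wci (extends_wired e g2)) => inp _.
  by rewrite /c'; case: ltnP; rewrite ?zi ?andbT ?andbF.
have e03 := extends_trans e02 e3.
have [gs4 e4 u4] := unary_max (extends_wf e3) (extends_unary e03 uc)
  (extends_unary e03 (uV z)).
have e04 := extends_trans e03 e4; rewrite size_enum_ord !muln1 in e04.
have [||||||gs5 e5 w5] := IH c' gs4.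
- exact: extends_wf e4.
- exact: extends_wired e04 wt.
- exact: extends_wired e04 w0.
- by move=> z'; apply: extends_unary e04 (uV z').
- apply: unary_eq u4 => inp _; rewrite /c' /maxn.
  by case: ltnP.
- by move=> i; apply: extends_wired e4 (w3 i _); rewrite mem_enum.
by exists gs5 => //=; rewrite mulSn; apply: extends_trans e04 e5.
Qed.

Section Simulator.
Variables n lam a q : nat.

Definition coins : nat := #|{: bits lam * 'I_q}|.

(** Distinct [z] read disjoint groups of [q] coins, so their noises are independent. *)
Definition block (r : bits coins) (z : bits lam) : bits q :=
  [tuple tnth r (enum_rank (z, i)) | i < q].

Definition perturbed (x : bits n) (Y : bits lam -> bits q)
    (fs : seq (bool * circuit)) (z : bits lam) : nat :=
  noise a (Y z) + count (fun f => signed_val f x z) fs.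

Definition zero_bits : bits lam := [tuple of nseq lam false].

(** The size counts two constants and, for each [z], the noise, the tests and one scan step. *)
Lemma simulator_circuit s W (fs : seq (bool * circuit)) :
  all (fun f => wf_circuit f.2 (n + lam) 1 && (csize f.2 <= s)) fs ->
  (forall x Y z, perturbed x Y fs z <= W) ->
  exists h, [/\ wf_circuit h (n + coins) lam,
    csize h <= 2 + 2 ^ lam * (q * (W.+1 * 2) + size fs * (s.+1 + W.+1 * 2)
                              + (W * 3 + 1 + lam + W.+1))
  & forall (x : bits n) (r : bits coins),
      eval h (x ++ r) = leader zero_bits (perturbed x (block r) fs)].
Proof.
set k := n + coins => afs leW.
have [gs1 e1 wt] := @synth_const k [::] true isT.
have [gs2 e2 w0] := synth_const false (extends_wf e1).
have e02 := extends_trans e1 e2.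
pose fl (z : bits lam) := [seq nth false ^~ (n + enum_rank (z, i)) | i <- enum 'I_q].
pose V z inp := noise a [seq f inp | f <- fl z]
  + count (fun f => signed_val f (take n inp) z) fs.
have VE z (x : bits n) (r : bits coins) : V z (x ++ r) = perturbed x (block r) fs z.
  rewrite /V /perturbed take_size_cat ?size_tuple //; congr (noise a _ + _).
  rewrite /fl -map_comp /=; apply: eq_map => i /=.
  by rewrite nth_cat size_tuple ltnNge leq_addr /= addKn (tnth_nth false).
have inpE inp : size inp = k -> exists (x : bits n) (r : bits coins), inp = x ++ r.
  move=> sz; have szx : size (take n inp) == n by rewrite size_take_min sz /k; lia.
  have szr : size (drop n inp) == coins by rewrite size_drop sz /k; lia.
  by exists (Tuple szx), (Tuple szr); rewrite /= cat_take_drop.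
have [||gs3 e3 uV] := @extends_seq k _ (enum {: bits lam})
  (fun z gs => unary k W gs (V z))
  (q * (W.+1 * 2) + size fs * (s.+1 + W.+1 * 2)) gs2 (extends_wf e2).
- by move=> z d g g' u e; apply: extends_unary e u.
- move=> z d g _ e; have wt' := extends_wired e (extends_wired e2 wt).
  have w0' := extends_wired e w0.
  have [|gs4 e4 u4] := unary_noise W a (extends_wf e) wt' w0' (fl := fl z).
    move=> i; rewrite size_map size_enum_ord => lti.
    rewrite (nth_map (Ordinal lti)) ?size_enum_ord //.
    by apply: wired_input; rewrite /k ltn_add2l ltn_ord.
  have [|gs5 e5 u5] := unary_add_count z _ (extends_wf e4) (extends_wired e4 wt')
    (extends_wired e4 w0') afs u4; first exact: leq_addr.
  by exists gs5 => //; rewrite size_map size_enum_ord in e4; apply: extends_trans e4 e5.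
have [||||gs6 e6 w6] := @wired_leader k W gs3 lam V zero_bits (extends_wf e3).
- exact: extends_wired e3 (extends_wired e2 wt).
- exact: extends_wired e3 w0.
- by move=> z; apply: uV; rewrite mem_enum.
- by move=> z inp /inpE[x [r ->]]; rewrite VE.
have [wf6 sz6 _] := extends_trans (extends_trans e02 e3) e6.
have [o oP] : exists o : {ffun 'I_lam -> nat}, forall i, o i < k + size gs6 /\
    forall inp, size inp = k ->
      nth false (run gs6 inp) (o i) = tnth (leader zero_bits (V ^~ inp)) i.
  have /fin_all_exists[o oP] i : exists w, w < k + size gs6 /\
      forall inp, size inp = k ->
      nth false (run gs6 inp) w = tnth (leader zero_bits (V ^~ inp)) i.
    by have [w] := w6 i; exists w.
  by exists [ffun i => o i] => i; rewrite ffunE.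
exists (Circuit gs6 [seq o i | i <- enum 'I_lam]); split.
- apply/and3P; split => //; first by rewrite size_map size_enum_ord.
  by apply/allP => _ /mapP[i _ ->]; case: (oP i).
- move: sz6; rewrite /csize /= add0n -cardE card_tuple card_bool.
  by rewrite -addnA -mulnDr.
- move=> x r; rewrite /eval /= -map_comp.
  have sz : size (x ++ r) = k by rewrite size_cat !size_tuple.
  rewrite -(map_tnth_enum (leader _ _)); apply: eq_map => i /=.
  by rewrite (oP i).2 //; congr tnth; apply: eq_leader => z; rewrite VE.
Qed.

End Simulator.

(** * Regret of the perturbed leader *)

Lemma card_bits_cons q (P : pred (seq bool)) :
  #|[set y : bits q.+1 | P y]| =
  #|[set y : bits q | P (true :: y)]| + #|[set y : bits q | P (false :: y)]|.
Proof.
pose S b := [set y : bits q | P (b :: y)].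
pose cons_bits b (y : bits q) : bits q.+1 := [tuple of b :: y].
have inj b : injective (cons_bits b).
  by move=> y y' /(congr1 val) /= [] /val_inj.
have -> : [set y : bits q.+1 | P y] =
    cons_bits true @: S true :|: cons_bits false @: S false.
  apply/setP => y; rewrite !inE; apply/idP/orP.
    rewrite (tuple_eta y) /=; case: (thead y) => Py; [left|right];
      apply/imsetP; exists [tuple of behead y]; rewrite ?inE //; exact: val_inj.
  by case=> /imsetP[y']; rewrite inE => Py' ->.
rewrite cardsU !card_imset //.
suff -> : cons_bits true @: S true :&: cons_bits false @: S false = set0.
  by rewrite cards0 subn0.
apply/setP => y; rewrite !inE; apply/negP => /andP[/imsetP[y1 _ ->] /imsetP[y2 _]].
by move=> /(congr1 val).
Qed.

(** For [v < lam], flipping the first zero matches the two sets. Only the all-ones string, at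
    [v = lam], has no partner; it accounts for the [+ 1]. *)
Lemma geo_hazard lam v :
  #|[set y : bits lam | geo y == v]| <= #|[set y : bits lam | v < geo y]| + 1.
Proof.
elim: lam v => [|lam IH] v.
  by apply: leq_trans (max_card _) _; rewrite card_tuple card_bool leq_addl.
rewrite (@card_bits_cons lam (fun y => geo y == v)).
rewrite (@card_bits_cons lam (fun y => v < geo y)) /=.
case: v => [|v].
  rewrite [X in X + _]eq_card0; last by move=> y; rewrite !inE.
  rewrite add0n -addnA; apply: leq_trans (leq_addr _ _).
  by apply: subset_leq_card; apply/subsetP => y; rewrite !inE.
rewrite [X in _ + X <= _]eq_card0; last by move=> y; rewrite !inE.
rewrite addn0; apply: leq_trans (leq_trans (IH v) _).
  by apply: subset_leq_card; apply/subsetP => y; rewrite !inE eqSS.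
rewrite leq_add2r; apply: leq_trans (leq_addr _ _).
by apply: subset_leq_card; apply/subsetP => y; rewrite !inE.
Qed.

(** For a noise [2 N + b], hitting [v] forces [b = odd v] and [N = v./2], while [N > v./2] puts it
    above [v] for both values of [b]. So each uniform bit halves the hazard rate. *)
Lemma noise_hazard a lam v :
  2 ^ a * #|[set y : bits (a + lam) | noise a y == v]| <=
  #|[set y : bits (a + lam) | v < noise a y]| + 2 ^ a.
Proof.
elim: a v => [|a IH] v; first by rewrite mul1n; apply: geo_hazard.
rewrite (@card_bits_cons (a + lam) (fun y => noise a.+1 y == v)).
rewrite (@card_bits_cons (a + lam) (fun y => v < noise a.+1 y)) /=.
have := IH v./2; set A := #|_|; set B := #|_| => leAB.
have leA b : #|[set y : bits (a + lam) | (noise a y).*2 + (b : bool) == v]| <=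
    (b == odd v) * A.
  case: eqP => [->|nb].
    rewrite mul1n; apply: subset_leq_card; apply/subsetP => y; rewrite !inE.
    by lia.
  rewrite leqn0 cards_eq0; apply/eqP/setP => y; rewrite !inE.
  by apply/eqP => E; apply: nb; rewrite -E; case: b {E}; lia.
have leB b : B <= #|[set y : bits (a + lam) | v < (noise a y).*2 + (b : bool)]|.
  apply: subset_leq_card; apply/subsetP => y; rewrite !inE.
  by have := odd_double_half v; case: (odd v); lia.
have := leA true; have := leA false; have := leB true; have := leB false.
rewrite expnS; case: (odd v) => /=; nia.
Qed.

Lemma geo_le y : geo y <= size y.
Proof. by elim: y => // -[] y IH //=. Qed.

Lemma noise_lt a lam y : size y = a + lam -> noise a y < 2 ^ a * lam.+1.
Proof.
elim: a y => [|a IH] y; first by move=> sz; rewrite mul1n ltnS -[lam]sz geo_le.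
case: y => [|b y] //= [] /IH; rewrite expnS; case: b; lia.
Qed.

Section Coordinate.
Variables I Y : finType.

Definition upd (r : {ffun I -> Y}) i y : {ffun I -> Y} :=
  [ffun j => if j == i then y else r j].

(* [(r, y) |-> (upd r i y, r i)] is an involution. *)
Lemma sum_upd (F : {ffun I -> Y} -> nat) i :
  \sum_r \sum_y F (upd r i y) = #|Y| * \sum_r F r.
Proof.
rewrite pair_big /=.
pose h (p : {ffun I -> Y} * Y) := (upd p.1 i p.2, p.1 i).
have hK : involutive h.
  case=> r y; rewrite /h /=; congr (_, _); last by rewrite ffunE eqxx.
  by apply/ffunP => j; rewrite !ffunE; case: eqP => // ->.
rewrite (reindex_inj (inv_inj hK)) /=.
rewrite (eq_bigr (fun p : {ffun I -> Y} * Y => F p.1)); last first.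
  move=> p _; congr F; apply/ffunP => j; rewrite !ffunE.
  by case: eqP => // ->.
rewrite -(pair_big xpredT xpredT (fun r (y : Y) => F r)) /= mulnC big_distrl /=.
by apply: eq_bigr => r _; rewrite sum_nat_const mulnC.
Qed.

End Coordinate.

Section Regret.
Variables (I Y : finType) (i0 : I) (N : Y -> nat) (w delta K : nat).
Hypothesis hazard : forall v,
  w * #|[set y | N y == v]| <= #|[set y | v < N y]| + delta.
Hypothesis delta_small : #|I| * delta <= #|Y|.
Hypothesis N_le : forall y, N y <= K.
Hypothesis Y_gt0 : 0 < #|Y|.

Let coin := {ffun I -> Y}.

Definition value (c : I -> nat) (r : coin) i := N (r i) + c i.
Definition lead (c : I -> nat) (r : coin) := leader i0 (value c r).
(** The best rival score. It is independent of the noise of [i], which can be resampled with the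
    rival fixed. *)
Definition runner (c : I -> nat) (r : coin) i := \max_(j | j != i) value c r j.

Lemma runner_upd c r i y : runner c (upd r i y) i = runner c r i.
Proof.
by apply: eq_bigr => j /negbTE neji; rewrite /value ffunE neji.
Qed.

Lemma strict_lead c r i e : runner c r i + e < value c r i -> lead c r = i.
Proof.
move=> lti; apply/eqP; apply: contraTT lti => nei; rewrite -leqNgt.
apply: leq_trans (leader_max i0 _ i) _; apply: leq_trans (leq_addr _ _).
exact: (@leq_bigmax_cond _ (fun j => j != i) (value c r)).
Qed.

(** Fix the other noises and resample that of [i]. Margin exactly [e] pins this noise to one value
    and any larger noise makes [i] the leader; [hazard] compares the two. *)
Lemma small_margin_coord c e i :
  w * (#|Y| * #|[set r | value c r i == runner c r i + e]|) <=
  #|Y| * #|[set r | lead c r == i]| + #|coin| * delta.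
Proof.
rewrite -!sum1dep_card big_mkcond /=.
rewrite [in X in _ <= X](big_mkcond (fun r => lead c r == i)) /=.
rewrite -!(sum_upd _ i) -sum_nat_const big_distrr -big_split /=.
apply: leq_sum => r _.
rewrite -!big_mkcond /= !sum1dep_card.
set v := runner c r i + e.
have -> : [set y | value c (upd r i y) i == runner c (upd r i y) i + e] =
    [set y | N y + c i == v].
  by apply/setP => y; rewrite !inE runner_upd /value ffunE eqxx.
(* If [v < c i], the event is empty; otherwise the truncated [v - c i] is a true difference. *)
have [ltvc|lecv] := ltnP v (c i).
  rewrite eq_card0 ?muln0 // => y; rewrite !inE; apply/eqP; lia.
have sub : #|[set y | v - c i < N y]| <= #|[set y | lead c (upd r i y) == i]|.
  apply: subset_leq_card; apply/subsetP => y; rewrite !inE => lty.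
  apply/eqP; apply: (@strict_lead _ _ _ e).
  by rewrite runner_upd /value ffunE eqxx -/v; lia.
apply: leq_trans (leq_trans (hazard (v - c i)) _); last by rewrite leq_add2r.
rewrite leq_mul2l; apply/orP; right; apply: subset_leq_card.
by apply/subsetP => y; rewrite !inE; lia.
Qed.

(** The events that [i] leads partition the coins and give one [#|coin|]; the errors [delta] of all
    [i] add at most another by [delta_small]. *)
Lemma small_margin c e :
  w * \sum_i #|[set r | value c r i == runner c r i + e]| <= 2 * #|coin|.
Proof.
rewrite -(leq_pmul2l Y_gt0) mulnCA big_distrr /= big_distrr /=.
apply: leq_trans (leq_sum _ (fun i _ => small_margin_coord c e i)) _.
rewrite big_split /= -big_distrr /= sum_nat_const.
have -> : \sum_i #|[set r | lead c r == i]| = #|coin|.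
  rewrite -sum1_card (partition_big (lead c) xpredT) //=.
  by apply: eq_bigr => i _; rewrite sum1dep_card.
by rewrite mulnCA mul2n -addnn mulnDr leq_add2l [leqRHS]mulnC leq_mul2l delta_small orbT.
Qed.

(** A leader with margin at least 2 survives increments of at most 1. So a change forces margin 0 or
    1, each bounded by [small_margin]. *)
Lemma lead_stable c c' : (forall i, c i <= c' i <= (c i).+1) ->
  w * #|[set r | lead c r != lead c' r]| <= 4 * #|coin|.
Proof.
move=> cc'.
suff sub : #|[set r | lead c r != lead c' r]| <=
    \sum_i #|[set r | value c r i == runner c r i + 0]| +
    \sum_i #|[set r | value c r i == runner c r i + 1]|.
  by have := small_margin c 0; have := small_margin c 1; nia.
rewrite -big_split /= -sum1dep_card (partition_big (lead c) xpredT) //=.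
apply: leq_sum => i _; rewrite sum1dep_card -cardsUI.
apply: leq_trans (leq_addr _ _); apply: subset_leq_card; apply/subsetP => r.
rewrite !inE => /andP[neq /eqP Li]; apply: contraNT neq => /norP[n0 n1].
have lead_i : runner c r i <= value c r i.
  by apply/bigmax_leqP => j _; rewrite -Li leader_max.
rewrite Li eq_sym; apply/eqP.
set j := lead c' r; apply/eqP/negPn/negP => neji.
have le_j : value c r j <= runner c r i.
  exact: (@leq_bigmax_cond _ (fun j => j != i) (value c r)).
have := leader_max i0 (value c' r) i; rewrite -/(lead c' r) -/j.
move: le_j lead_i n0 n1 (cc' i) (cc' j); rewrite /value; lia.
Qed.

(** [c] and [f] do not depend on the coins, so one draw of the noise serves all rounds and [K] is
    paid once. *)
Lemma lead_regret (c : nat -> I -> nat) (f : nat -> I -> bool) T i :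
  (forall i, c 0 i = 0) -> (forall t i, c t.+1 i = c t i + f t i) ->
  w * (#|coin| * c T i) <=
  w * (\sum_(t < T) \sum_r (f t (lead (c t) r) : nat)) + w * (#|coin| * K)
  + T * (4 * #|coin|).
Proof.
move=> c0 cS.
(* Be the leader: choosing with the current test already counted has regret at most [K]. *)
have btl r t : value (c t) r (lead (c t) r) <=
    K + \sum_(j < t) (f j (lead (c j.+1) r) : nat).
  elim: t => [|t IH]; first by rewrite big_ord0 addn0 /value c0 addn0.
  rewrite big_ord_recr /= addnA {1}/value cS addnA leq_add2r.
  exact: leq_trans (leader_max i0 (value (c t) r) _) IH.
(* Not knowing test [t] yet costs something only if that test changes the leader. *)
have switch r t : (f t (lead (c t.+1) r) : nat) <=
    f t (lead (c t) r) + (lead (c t) r != lead (c t.+1) r).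
  by case: eqVneq => [->|_]; [rewrite addn0 | case: (f t _); rewrite addn1].
have stable t : w * \sum_r ((lead (c t) r != lead (c t.+1) r) : nat) <= 4 * #|coin|.
  rewrite -big_mkcond /= sum1dep_card; apply: lead_stable => j; rewrite cS.
  by case: (f t j); lia.
have : \sum_(r : coin) c T i <= \sum_(r : coin) (K + \sum_(t < T)
    (f t (lead (c t) r) + (lead (c t) r != lead (c t.+1) r))).
  apply: leq_sum => r _; apply: leq_trans (_ : _ <= value (c T) r i) _.
    exact: leq_addl.
  apply: leq_trans (leader_max i0 _ _) _; apply: leq_trans (btl r T) _.
  by rewrite leq_add2l; apply: leq_sum.
rewrite big_split /= !sum_nat_const exchange_big /=.
under eq_bigr do rewrite big_split.
rewrite big_split /= => le_all.
have : w * \sum_(t < T) \sum_r ((lead (c t) r != lead (c t.+1) r) : nat) <=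
    T * (4 * #|coin|).
  rewrite big_distrr /= -[X in X * _](card_ord T) -sum_nat_const.
  by apply: leq_sum => t _; apply: stable.
move: le_all; set S1 := \sum_(_ < T) _; set S2 := \sum_(_ < T) _.
rewrite -[#|_|]/(#|coin|); move: #|coin| => M le_all le_sw.
by nia.
Qed.

End Regret.

(** * The advantage of a test against a simulator *)

Local Open Scope ring_scope.

Section Advantage.
Variables (R : realType) (n lam m : nat) (P : {ffun jtype n lam -> R}).
Variable H : bits n -> bits m -> bits lam.
Implicit Type g : bits n -> bits lam -> bool.

(** Written pointwise: a mean over [P] of the loss of [H] against the expert [y.2], so that regret
    bounds apply to each [y]. *)
Definition advantage g : R := \sum_y P y *
  ((g y.1 y.2 : nat)%:R - (\sum_r (g y.1 (H y.1 r) : nat))%:R / 2 ^+ m).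

Lemma prD_sim_joint h D : (forall x r, eval h (val x ++ val r) = H x r) ->
  prD P D - prD (sim_joint P m h) D = advantage (fun x z => eval1 D (val x ++ val z)).
Proof.
move=> hE; rewrite /prD /advantage.
rewrite [X in _ - X](_ : _ = \sum_(y : jtype n lam) P y *
   ((\sum_r (eval1 D (val y.1 ++ val (H y.1 r)) : nat))%:R / 2 ^+ m)).
  by rewrite -sumrB; apply: eq_bigr => y _; rewrite mulrBr.
rewrite [RHS](eq_bigr (fun y : jtype n lam => P (y.1, y.2) *
   ((\sum_r (eval1 D (val y.1 ++ val (H y.1 r)) : nat))%:R / 2 ^+ m))); last by case.
rewrite -(pair_bigA _ (fun x z => P (x, z) *
   ((\sum_r (eval1 D (val x ++ val (H x r)) : nat))%:R / 2 ^+ m))) /=.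
rewrite (eq_bigr (fun y : jtype n lam => sim_joint P m h (y.1, y.2) *
   (eval1 D (val y.1 ++ val y.2) : nat)%:R)); last by case.
rewrite -(pair_bigA _ (fun x z => sim_joint P m h (x, z) *
   (eval1 D (val x ++ val z) : nat)%:R)) /=.
apply: eq_bigr => x _; rewrite -mulr_suml.
(* Grouping the coins by the output of [H x] yields the counts in [sim_joint]. *)
rewrite (partition_big (H x) xpredT) //= natr_sum [X in _ * X]mulr_suml mulr_sumr.
apply: eq_bigr => z _; rewrite ffunE /= -mulrA; congr (_ * _).
rewrite mulrAC; congr (_ / _); rewrite -natrM; congr _%:R.
rewrite -sum1dep_card big_distrl /=.
apply: eq_big => [r|r /eqP E]; first by rewrite hE.
by rewrite mul1n; congr (eval1 D (_ ++ _) : nat); apply: esym; rewrite -hE.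
Qed.

Lemma advantageN g : advantage (fun x z => ~~ g x z) = - advantage g.
Proof.
rewrite /advantage -sumrN; apply: eq_bigr => y _; rewrite -[RHS]mulrN; congr (_ * _).
have -> : (\sum_r (~~ g y.1 (H y.1 r) : nat) =
           2 ^ m - \sum_r (g y.1 (H y.1 r) : nat))%N.
  have <- : (\sum_(r : bits m) 1 = 2 ^ m)%N by rewrite sum1_card card_tuple card_bool.
  apply/eqP; rewrite -(eqn_add2r (\sum_r (g y.1 (H y.1 r) : nat))) subnK.
    rewrite -big_split; apply/eqP; apply: eq_bigr => r _.
    by case: (g _ _).
  by apply: leq_sum => r _; case: (g _ _).
rewrite natrB ?natrX; last first.
  have <- : (\sum_(r : bits m) 1 = 2 ^ m)%N by rewrite sum1_card card_tuple card_bool.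
  by apply: leq_sum => r _; case: (g _ _).
have nz : 2 ^+ m != 0 :> R by rewrite expf_neq0 // pnatr_eq0.
by rewrite mulrBl divff //; case: (g _ _) => /=; ring.
Qed.

Lemma advantage_le1 g : is_distr P -> advantage g <= 1.
Proof.
move=> [P0 <-]; apply: ler_sum => y _; rewrite -[leRHS]mulr1.
apply: ler_wpM2l => //; rewrite lerBlDr; apply: ler_wpDr.
  by rewrite divr_ge0 // exprn_ge0.
by case: (g _ _).
Qed.

(** The sign of [f] resolves the absolute value: a negative gap becomes a positive advantage of the
    negated test. *)
Lemma not_indist_advantage s eps h : (forall x r, eval h (val x ++ val r) = H x r) ->
  ~ indist s eps (sim_joint P m h) P ->
  exists f : bool * circuit, [/\ wf_circuit f.2 (n + lam) 1, (csize f.2 <= s)%N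
    & eps < advantage (fun x z => signed_val f (val x) (val z))].
Proof.
move=> hE; rewrite /indist => /existsNP[D] /not_implyP[wfD] /not_implyP[szD].
move/negP; rewrite -ltNge distrC (prD_sim_joint _ hE).
rewrite lter_normr => /orP[lt|lt]; [exists (false, D)|exists (true, D)]; split=> //.
by rewrite -advantageN in lt.
Qed.

End Advantage.

Lemma indist_eps_ge1 (R : realType) n lam s (P : {ffun jtype n lam -> R}) eps :
  is_distr P -> 1 <= eps ->
  exists h, [/\ wf_circuit h (n + lam) lam, indist s eps (sim_joint P lam h) P
              & csize h = 0%N].
Proof.
move=> dP e1; exists (Circuit [::] (iota n lam)); split=> //.
  rewrite /wf_circuit /= size_iota eqxx /=; apply/allP => o.
  by rewrite mem_iota /csize /=; lia.
apply: contrapT => /(@not_indist_advantage _ _ _ _ _ (fun _ r => r))[].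
  move=> x r; rewrite /eval /= map_nth_iota ?size_cat ?size_tuple ?addKn //.
  by rewrite drop_size_cat ?take_oversize ?size_tuple.
by move=> f [_ _] /(le_lt_trans e1); rewrite ltNge advantage_le1.
Qed.

(** * Random bits as independent noise *)

Section Blocks.
Variables lam q : nat.

Definition blocks (r : bits (coins lam q)) : {ffun bits lam -> bits q} :=
  [ffun z => block r z].

Lemma blocks_bij : bijective blocks.
Proof.
exists (fun Y : {ffun bits lam -> bits q} =>
  [tuple tnth (Y (enum_val j).1) (enum_val j).2 | j < coins lam q]).
  move=> r; apply: eq_from_tnth => j; rewrite tnth_mktuple ffunE tnth_mktuple.
  by rewrite -surjective_pairing enum_valK.
move=> Y; apply/ffunP => z; rewrite ffunE; apply: eq_from_tnth => i.
by rewrite !tnth_mktuple enum_rankK.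
Qed.

End Blocks.

(** * Total advantage of a sequence of tests *)

Section Learning.
Variables (R : realType) (n lam a : nat) (P : {ffun jtype n lam -> R}) (eps : R).
Hypotheses (dP : is_distr P) (large_a : 8 <= eps * 2 ^+ a).

Definition rounds := (lam.+1 * 2 ^ a * 2 ^ a)%N.

Definition simulator (fs : seq (bool * circuit)) (x : bits n)
    (r : bits (coins lam (a + lam))) : bits lam :=
  leader (zero_bits lam) (perturbed a x (block r) fs).

(** For each [(x, z)] the sum is the regret against expert [z] divided by the number of coin
    strings. It is at most [5 * lam.+1 * 2 ^ a], while [eps * rounds] is at least
    [8 * lam.+1 * 2 ^ a]. *)
Lemma sum_advantage_le (fs : nat -> seq (bool * circuit)) (f : nat -> bool * circuit) :
  fs 0%N = [::] -> (forall t, fs t.+1 = rcons (fs t) (f t)) ->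
  \sum_(t < rounds) advantage P (simulator (fs t))
     (fun x z => signed_val (f t) (val x) (val z)) <= eps * rounds%:R.
Proof.
pose T := rounds; rewrite -/T; move=> fs0 fsS; rewrite exchange_big /=.
rewrite -[leRHS]mulr1 -[X in _ <= _ * X]dP.2 mulr_sumr; apply: ler_sum => -[x z] _ /=.
rewrite -mulr_sumr mulrC; apply: ler_wpM2r; first exact: dP.1.
have cY : #|{: bits (a + lam)}| = (2 ^ (a + lam))%N by rewrite card_tuple card_bool.
have cI : #|{: bits lam}| = (2 ^ lam)%N by rewrite card_tuple card_bool.
have dsmall : (#|{: bits lam}| * 2 ^ a <= #|{: bits (a + lam)}|)%N.
  by rewrite cY cI expnD mulnC.
have N_le (y : bits (a + lam)) : (noise a y <= 2 ^ a * lam.+1)%N.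
  by apply/ltnW/noise_lt; rewrite size_tuple.
have Y_gt0 : (0 < #|{: bits (a + lam)}|)%N by rewrite cY expn_gt0.
pose g t (i : bits lam) := signed_val (f t) x i.
pose cnt t (i : bits lam) := count (fun f => signed_val f x i) (fs t).
have cnt0 i : cnt 0%N i = 0%N by rewrite /cnt fs0.
have cntS t i : cnt t.+1 i = (cnt t i + g t i)%N.
  by rewrite /cnt fsS -cats1 count_cat /= addn0.
have := lead_regret (c := cnt) (f := g) (zero_bits lam) (noise_hazard a lam)
  dsmall N_le Y_gt0 T z cnt0 cntS.
have -> : #|{ffun bits lam -> bits (a + lam)}| = (2 ^ coins lam (a + lam))%N.
  by rewrite -(bij_eq_card (@blocks_bij lam (a + lam))) card_tuple card_bool.
set M := (2 ^ coins lam (a + lam))%N; set S := (\sum_(t < T) _)%N => le_regret.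
have SE : S = (\sum_(t < T) \sum_r
    (signed_val (f t) x (val (simulator (fs t) x r)) : nat))%N.
  apply: eq_bigr => t _; rewrite (reindex _ (onW_bij _ (@blocks_bij lam (a + lam)))) /=.
  apply: eq_bigr => r _; congr (signed_val _ _ (val _) : nat).
  by apply: eq_leader => z'; rewrite /value /perturbed ffunE.
have cntE : (cnt T z = \sum_(t < T) signed_val (f t) x z)%N.
  elim: (T) => [|t IH]; first by rewrite big_ord0 cnt0.
  by rewrite big_ord_recr /= -IH cntS.
have -> : \sum_(t < T) ((signed_val (f t) x z : nat)%:R -
    (\sum_r (signed_val (f t) x (simulator (fs t) x r) : nat))%:R / 2 ^+ coins lam (a + lam))
    = (cnt T z)%:R - S%:R / M%:R :> R.
  by rewrite sumrB -mulr_suml -!natr_sum -SE cntE natrX.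
move: le_regret; set c := cnt T z.
rewrite -(ler_nat R) !natrD !natrM => le_regret.
have w_gt0 : 0 < (2 ^ a)%:R :> R by rewrite ltr0n expn_gt0.
have M_gt0 : 0 < M%:R :> R by rewrite ltr0n expn_gt0.
have large : 8 <= eps * (2 ^ a)%:R by rewrite natrX.
move: le_regret large.
set w := (2 ^ a)%:R in w_gt0 *; set L := (lam.+1)%:R; set m := M%:R in M_gt0 *.
move=> le_regret large.
have L_gt0 : 0 < L by rewrite ltr0n.
have {}le_regret : c%:R <= S%:R / m + w * L + L * w * 4.
  rewrite -(ler_pM2l (mulr_gt0 w_gt0 M_gt0)) -/m.
  have -> : w * m * (S%:R / m + w * L + L * w * 4) =
    w * S%:R + w * (m * (w * L)) + L * w * w * (4 * m).
    by field; rewrite gt_eqF.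
  by rewrite -mulrA.
rewrite lerBlDl; apply: le_trans le_regret _; rewrite -addrA lerD2l.
have -> : eps * (L * w * w) = (L * w) * (eps * w) by ring.
have -> : w * L + L * w * 4 = (L * w) * 5 by ring.
by apply: ler_wpM2l; [rewrite mulr_ge0 // ltW | lra].
Qed.

End Learning.

(** * Circuit size and choice of parameters *)

Lemma sqr_le_exp2 l : (l.+1 ^ 2 <= 3 * 2 ^ l)%N.
Proof.
elim: l => // -[|[|l]] // IH; rewrite expnS.
by move: IH; rewrite !expnS !expn0; nia.
Qed.

(** Let [B = 2 ^ a], [E = 2 ^ lam] and [T = lam.+1 * B ^ 2]. The terms [a], [lam], [t] and
    [lam.+1 * B] are at most [T], so the bracket is at most [36 * s * T ^ 2], and
    [T ^ 2 <= 3 * E * B ^ 4]. This gives the factor 108; the slack up to 120 absorbs the two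
    constants. *)
Lemma simulator_size lam a s t W : (0 < s)%N -> (t <= rounds lam a)%N ->
  W = (2 ^ a * lam.+1 + rounds lam a)%N ->
  (2 + 2 ^ lam * ((a + lam) * (W.+1 * 2) + t * (s.+1 + W.+1 * 2)
     + (W * 3 + 1 + lam + W.+1)) <= 120 * s * 2 ^ (2 * lam) * (2 ^ a) ^ 4)%N.
Proof.
move=> s0 tT ->; have la : (a < 2 ^ a)%N by apply: ltn_expl.
have := sqr_le_exp2 lam; rewrite mul2n -addnn expnD.
have : (0 < 2 ^ lam)%N by rewrite expn_gt0.
move: tT; rewrite /rounds; move: (2 ^ lam)%N (2 ^ a)%N la => E B la.
set u := lam.+1 => tT E0 uE.
pose T := (u * B * B)%N.
have u0 : (0 < u)%N by [].
have T1 : (u * B <= T)%N by rewrite /T; nia.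
have T2 : (a <= T)%N by rewrite /T; nia.
have T3 : (lam < T)%N by rewrite -/u /T; nia.
have le1 : ((a + lam) * ((B * u + u * B * B).+1 * 2)
     + t * (s.+1 + (B * u + u * B * B).+1 * 2)
     + ((B * u + u * B * B) * 3 + 1 + lam + (B * u + u * B * B).+1) <= 36 * s * (T * T))%N.
  rewrite [(B * u)%N]mulnC; move: tT; rewrite -/T; move: (u * B)%N T1 => K T1 tT.
  have h1 : ((a + lam) * ((K + T).+1 * 2) <= (T + T) * (3 * T * 2))%N.
    by apply: leq_mul; lia.
  have h2 : (t * (s.+1 + (K + T).+1 * 2) <= T * (2 * s * T + 3 * T * 2 * s))%N.
    by apply: leq_mul => //; nia.
  have h3 : ((K + T) * 3 + 1 + lam + (K + T).+1 <= 12 * T)%N by lia.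
  have h4 : (T <= T * T)%N by nia.
  have h5 : (T * T <= s * (T * T))%N by nia.
  by nia.
have le2 : (T * T <= 3 * E * B ^ 4)%N.
  have -> : (T * T = u ^ 2 * B ^ 4)%N by rewrite /T; ring.
  by rewrite leq_mul2r uE orbT.
have B1 : (1 <= B ^ 4)%N by rewrite expn_gt0; lia.
apply: (@leq_trans (2 + E * (36 * s * (3 * E * B ^ 4)))).
  by rewrite leq_add2l leq_mul2l (leq_trans le1) ?orbT // leq_mul2l le2 orbT.
have e1 : (1 <= E * E)%N by nia.
have e2 : (1 <= s * (E * E) * B ^ 4)%N 
  by apply: (@leq_mul 1 1) => //; rewrite !muln_gt0 s0 E0.
move: (B ^ 4)%N B1 e2 => X _ e2; nia.
Qed.

(** The least [a] works, by minimality; [1 < x] rules out [a = 0]. *)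
Lemma exp2_approx (R : realType) (x : R) : 1 < x ->
  exists a, x <= 2 ^+ a <= 2 * x.
Proof.
move=> x1.
have ex : exists a, x <= 2 ^+ a.
  exists (Num.bound x); rewrite -natrX.
  apply: le_trans (ltW (archi_boundP (ltW (lt_trans ltr01 x1)))) _.
  by rewrite ler_nat ltnW // ltn_expl.
exists (ex_minn ex); case: ex_minnP => -[|a] xa min; first by rewrite expr0 leNgt x1 in xa.
rewrite xa exprS ler_pM2l //= ltW // ltNge.
by apply/negP => /min; rewrite ltnn.
Qed.

Theorem theorem3 (R : realType) :
  exists C : R, 0 < C /\
  forall (n lam s : nat) (P : {ffun jtype n lam -> R}) (eps : R),
    is_distr P -> 0 < eps -> (0 < s)%N ->
    exists (m : nat) (h : circuit),
      [/\ wf_circuit h (n + m) lam,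
          indist s eps (sim_joint P m h) P
        & (csize h)%:R <= C * s%:R * 2 ^+ (2 * lam) / eps ^+ 4].
Proof.
(* [120] comes from [simulator_size], and [16 ^+ 4] from [2 ^ a <= 16 / eps]. *)
exists (120 * 16 ^+ 4); split; first by rewrite mulr_gt0 ?exprn_gt0.
move=> n lam s P eps dP eps0 s0.
have [e1|e1] := leP 1 eps.
  have [h [wf ind sz]] := indist_eps_ge1 s dP e1; exists lam, h; split=> //.
  rewrite sz divr_ge0 ?exprn_ge0 ?(ltW eps0) // mulr_ge0 ?exprn_ge0 //.
  by rewrite !mulr_ge0 ?exprn_ge0.
have [a /andP[a_ge a_le]] : exists a, 8 / eps <= 2 ^+ a <= 2 * (8 / eps).
  by apply: exp2_approx; rewrite ltr_pdivlMr // mul1r (lt_trans e1) // ltr1n.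
have large_a : 8 <= eps * 2 ^+ a by rewrite mulrC -ler_pdivrMr.
apply: contrapT => none.
pose T := rounds lam a.
pose ok (fs : seq (bool * circuit)) :=
  all (fun f => wf_circuit f.2 (n + lam) 1 && (csize f.2 <= s)%N) fs.
(* Each failing simulator yields a new test. [choice] needs a total function, so lists that are too
   long or not [ok] get a dummy. *)
have /choice[next nextP] fs : exists f : bool * circuit, ok fs -> (size fs <= T)%N ->
    ok [:: f] /\ eps < advantage P (simulator (a := a) fs)
                         (fun x z => signed_val f (val x) (val z)).
  have [okfs|nok] := boolP (ok fs); last by exists (false, Circuit [::] [::]).
  have [szfs|] := leqP (size fs) T; last by exists (false, Circuit [::] [::]).
  pose W := (2 ^ a * lam.+1 + T)%N.
  have leW (x : bits n) (Y : bits lam -> bits (a + lam)) z : (perturbed a x Y fs z <= W)%N.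
    apply: leq_add; first by apply/ltnW/noise_lt; rewrite size_tuple.
    exact: leq_trans (count_size _ _) szfs.
  have [h [wfh szh hE]] := simulator_circuit okfs leW.
  have [|f [wff szf adv]] := @not_indist_advantage R n lam _ P (simulator (a := a) fs) s eps h hE.
    move=> ind; apply: none; exists (coins lam (a + lam)), h; split=> //.
    have := leq_trans szh (simulator_size s0 szfs (erefl W)).
    rewrite -(ler_nat R) => /le_trans; apply.
    rewrite !natrM !natrX -[leRHS]mulrA mulrAC.
    have B4 : (2 ^+ a) ^+ 4 <= 16 ^+ 4 / eps ^+ 4 :> R.
      rewrite -expr_div_n lerXn2r ?nnegrE ?exprn_ge0 ?divr_ge0 ?(ltW eps0) //.
      by apply: le_trans a_le _; rewrite mulrA -natrM.
    have -> : 120 * 16 ^+ 4 * s%:R * (2 ^+ (2 * lam) / eps ^+ 4) =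
      120%:R * s%:R * 2 ^+ (2 * lam) * (16 ^+ 4 / eps ^+ 4) :> R by field; rewrite gt_eqF.
    by rewrite mulrAC; apply: ler_wpM2l B4; rewrite !mulr_ge0 ?exprn_ge0.
  by exists f => _ _; rewrite /ok /= wff szf.
pose fs := fix fs t := if t is t'.+1 then rcons (fs t') (next (fs t')) else [::].
(* The invariant is claimed only for [t <= T], where [next] truly distinguishes. *)
have fsP t : ok (fs t) /\ size (fs t) = t \/ (T < t)%N.
  elim: t => [|t [[okt szt]|ltt]]; [by left| |by right; rewrite ltnW].
  have [leT|] := leqP t.+1 T; last by right.
  have [] := nextP (fs t) okt _; first by rewrite szt ltnW.
  rewrite /ok /= andbT => okn _; left.
  by rewrite /= size_rcons szt /ok all_rcons okn.
have := @sum_advantage_le R n lam a P eps dP large_a fs (next \o fs) erefl (fun=> erefl).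
apply/negP; rewrite -ltNge -/T.
(* Comparing the sums strictly requires at least one round. *)
have T0 : (0 < T)%N by rewrite /T /rounds !muln_gt0 expn_gt0.
have -> : eps * T%:R = \sum_(t < T) eps by rewrite sumr_const card_ord mulr_natr.
have gt t : (t < T)%N -> eps < advantage P (simulator (a := a) (fs t))
    (fun x z => signed_val (next (fs t)) (val x) (val z)).
  move=> ltT; have [[okt szt]|] := fsP t; last by rewrite ltnNge ltnW.
  by have [] := nextP (fs t) okt _; rewrite ?szt ?(ltnW ltT).
apply: ltr_sum => [|t _]; last exact: gt.
by apply/hasP; exists (Ordinal T0); rewrite ?mem_index_enum.
Qed.
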